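(* For every rational constant $0<c\le1$ and every $\varepsilon>0$, any (possibly randomized) algorithm for monotone submodular maximization subject to a cardinality constraint $k=cn$ that achieves an approximation ratio of $(1+\varepsilon)\rho(c)$ requires exponentially many (in $n$) value queries.
   Context: Monotone submodular maximization subject to a cardinality constraint: given value-oracle access to a nonnegative monotone submodular $f\colon2^U\to\mathbb{R}_{\ge0}$ with $|U|=n$ (submodular: $f(A)+f(B)\ge f(A\cup B)+f(A\cap B)$; monotone: $A\subseteq B\Rightarrow f(A)\le f(B)$) and $k$, find $S\subseteq U$, $|S|\le k$, maximizing $f(S)$; here $k=cn$. Definition of $\rho(c)$: for $\alpha\in[0,1]$ and integer $m\ge1$ let $\sigma(\alpha,m)=\bigl(1-\alpha c-(1-\alpha)/m\bigr)^m$. If $c=1/s$ for some integer $s\ge1$, then $\rho(c)=1-(1-c)^{1/c}$. Otherwise $1/(s+1)<c<1/s$ for a unique integer $s\ge1$, there is a unique $\alpha^*\in(0,1)$ with $\sigma(\alpha^*,s)=\sigma(\alpha^*,s+1)$, and $\rho(c)=1-\sigma(\alpha^*,s)$. *)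

(* Defs.v *)
From HB Require Import structures.
From mathcomp Require Import all_boot all_order all_algebra.
From mathcomp Require Import all_classical all_reals all_analysis.
Set Implicit Arguments. Unset Strict Implicit. Unset Printing Implicit Defensive.
Import Order.TTheory GRing.Theory Num.Theory.
Local Open Scope classical_set_scope.
Local Open Scope ring_scope.

Section SubmodularQueries.
Variable R : realType.
Variable n : nat.

Definition setfun := {set 'I_n} -> R.

Definition nonneg_setfun (f : setfun) : Prop := forall S, 0 <= f S.
Definition monotone_setfun (f : setfun) : Prop :=
  forall A B : {set 'I_n}, A \subset B -> f A <= f B.
Definition submodular (f : setfun) : Prop :=
  forall A B : {set 'I_n}, f (A :|: B) + f (A :&: B) <= f A + f B.

Definition valid_instance (f : setfun) : Prop :=
  [/\ nonneg_setfun f, monotone_setfun f & submodular f].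

(* OPT = max { f S : |S| <= k } (f nonnegative, so 0 is a harmless default). *)
Definition opt (f : setfun) (k : nat) : R :=
  \big[Num.max/0]_(S : {set 'I_n} | (#|S| <= k)%N) f S.

(* Deterministic adaptive value-oracle algorithm: a (well-founded) decision
   tree which either outputs a set or queries the value of a set and continues
   depending on the (real) answer. *)
Inductive qalg : Type :=
| QOut of {set 'I_n}
| QAsk of {set 'I_n} & (R -> qalg).

Fixpoint run (f : setfun) (A : qalg) : {set 'I_n} * nat :=
  match A with
  | QOut X => (X, 0%N)
  | QAsk X k => let p := run f (k (f X)) in (p.1, p.2.+1)
  end.

Definition qout (f : setfun) (A : qalg) : {set 'I_n} := (run f A).1.
Definition nqueries (f : setfun) (A : qalg) : nat := (run f A).2.

Definition out_value (f : setfun) (k : nat) (S : {set 'I_n}) : R :=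
  if (#|S| <= k)%N then f S else 0.

(* A randomized algorithm: a random deterministic algorithm A : Omega -> qalg
   over a probability space (Omega, P); measurability of the output and of
   the number of queries, for every oracle. *)
Definition ralg_measurable d (Omega : measurableType d) (A : Omega -> qalg) : Prop :=
  (forall (f : setfun) (S : {set 'I_n}), measurable [set w : Omega | qout f (A w) = S]) /\
  (forall (f : setfun) (m : nat), measurable [set w : Omega | nqueries f (A w) = m]).

Definition expected_value d (Omega : measurableType d) (P : probability Omega R)
    (A : Omega -> qalg) (f : setfun) (k : nat) : \bar R :=
  (\int[P]_w (out_value f k (qout f (A w)))%:E)%E.

End SubmodularQueries.

Section Rho.
Variable R : realType.

Definition sigma_fn (c alpha : R) (m : nat) : R :=
  (1 - alpha * c - (1 - alpha) / m%:R) ^+ m.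

(* is_rho c r : r = rho(c), following the paper's definition literally
   (for c = 1/s, (1-c)^(1/c) = (1-c)^s). *)
Definition is_rho (c r : R) : Prop :=
  (exists s : nat, [/\ (0 < s)%N, c = (s%:R)^-1 & r = 1 - (1 - c) ^+ s]) \/
  (exists (s : nat) (alpha : R),
     [/\ (0 < s)%N, (s.+1%:R)^-1 < c < (s%:R)^-1, 0 < alpha < 1,
         sigma_fn c alpha s = sigma_fn c alpha s.+1 &
         r = 1 - sigma_fn c alpha s]).
End Rho.

(* Main.v *)
Require Import Defs.
From HB Require Import structures.
From mathcomp Require Import all_boot all_order all_algebra.
From mathcomp Require Import all_classical all_reals all_analysis.
From mathcomp Require Import measurable_realfun ring lra.
Import Order.TTheory GRing.Theory Num.Theory.
Local Open Scope classical_set_scope.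
Local Open Scope ring_scope.

(* Let [1/(s+1) <= c <= 1/s].  The ground set is cut into [k] groups of [s] or
   [s+1] elements, and the hidden set takes a random element of each group.
   On the class of all groups of size [m], let [o] and [t] be the numbers of
   hidden and of other chosen elements, divided by the number of groups.  The
   uncovered fraction is [(1 - (o+t)/m)^m], except when hidden elements are
   over-represented by more than a small [d], where it is
   [(1-o') (1-t'/(m-1))^(m-1)], for [o' = o - d] and [t' = t + d].  The second
   expression is the tangent of [x^m] at [1-t'/(m-1)], evaluated at
   [1-(o+t)/m], so the two pieces match to first order and the covered fraction
   is submodular.  The hidden set covers almost everything, whereas by a Chernoff
   bound a fixed query falls, up to exponentially small probability, in the zone
   where the answer does not depend on the hidden set.

   The objective is a weighted sum of the two classes.  A set of size [k] that
   ignores the hidden set takes fractions [x] and [y] of the two classes, and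
   with the weights given by Lagrange's condition at [x = alpha c + (1-alpha)/s],
   [y = alpha c + (1-alpha)/(s+1)], [alpha = alpha^*], it gets at most [rho(c)]. *)

(** * Tangent extensions of powers *)

(* The tangent line of [x ^+ q.+1] at [b], evaluated at [a]. *)
Definition tang {R : realFieldType} (q : nat) (b a : R) : R :=
  b ^+ q * (q.+1%:R * a - q%:R * b).

Section Tangent.
Context {R : realFieldType}.
Implicit Types (a b C x : R) (q : nat).

Lemma tang_diag q b : tang q b b = b ^+ q.+1.
Proof. by rewrite /tang exprSr -!natr1; ring. Qed.

(** Convexity of powers without derivatives, by induction on [q]: [x] times the tangent exceeds the
    next tangent by [(q+1) b^q (x - b)^2]. *)
Lemma tang_le q b x : 0 <= b -> 0 <= x -> tang q b x <= x ^+ q.+1.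
Proof.
move=> b0 x0; elim: q => [|q IH].
  by rewrite /tang expr0 expr1 !mul1r mul0r subr0.
rewrite exprS; apply: (@le_trans _ _ (x * tang q b x)); last by rewrite ler_wpM2l.
have -> : x * tang q b x = tang q.+1 b x + q.+1%:R * b ^+ q * (x - b) ^+ 2.
  by rewrite /tang !exprS -!natr1; ring.
by rewrite lerDl mulr_ge0 ?sqr_ge0 // mulr_ge0 ?exprn_ge0.
Qed.

(** The difference is the gap at [b] between the power and its tangent from [b'], plus the increase
    of slope times [b - a]. *)
Lemma tang_anti q a b b' : 0 <= b -> a <= b -> b <= b' -> tang q b' a <= tang q b a.
Proof.
move=> b0 ab bb'; have b'0 := le_trans b0 bb'.
have H : tang q b' b <= b ^+ q.+1 by apply: tang_le.
have E : tang q b a - tang q b' a =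
    (b ^+ q.+1 - tang q b' b) + q.+1%:R * (b - a) * (b' ^+ q - b ^+ q).
  by rewrite /tang !exprS -!natr1; ring.
rewrite -subr_ge0 E addr_ge0 ?subr_ge0 // mulr_ge0 //.
  by rewrite mulr_ge0 // subr_ge0.
by rewrite subr_ge0 lerXn2r ?nnegrE.
Qed.

End Tangent.

(* [x ^+ q.+1] for [x >= b], continued by its tangent line to the left of [b]. *)
Definition psi {R : realFieldType} (q : nat) (b a : R) : R := tang q (Num.max a b) a.

Section Psi.
Context {R : realFieldType}.
Implicit Types (a b C x : R) (q : nat).

Lemma psi_ge q b a : b <= a -> psi q b a = a ^+ q.+1.
Proof. by move=> ba; rewrite /psi (max_idPl ba) tang_diag. Qed.

Lemma psi_le q b a : a <= b -> psi q b a = tang q b a.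
Proof. by move=> ab; rewrite /psi (max_idPr ab). Qed.

(** On either branch the tangent based at [max a1 b] supports [psi] at [a1]. *)
Lemma psi_subgradient q b a1 a2 : 0 <= a1 -> 0 <= a2 ->
  psi q b a1 + q.+1%:R * Num.max a1 b ^+ q * (a2 - a1) <= psi q b a2.
Proof.
move=> a10 a20.
have -> : psi q b a1 + q.+1%:R * Num.max a1 b ^+ q * (a2 - a1) =
    tang q (Num.max a1 b) a2 by rewrite /psi /tang; ring.
have [ab1|ab1] := leP a1 b; have [ab2|ab2] := leP a2 b.
- by rewrite psi_le.
- by rewrite psi_ge ?(ltW ab2) // tang_le // (le_trans a10).
- rewrite psi_le //; apply: tang_anti => //; [exact: le_trans ab2|exact: ltW].
- by rewrite psi_ge ?(ltW ab2) // tang_le.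
Qed.

(** Needed for non-hidden elements, which move both arguments of [psi]. The last argument is a
    weighted mean of [C] and [b], so the sign of [C - b] decides the branch: a power of the mean for
    [b <= C], and [C * b^(q+1)] beyond, with equal slopes at [b = C]. The support slope [g >= 0]
    gives monotonicity and convexity at once. *)
Lemma psi_subgradient_diag q C b1 : 0 <= C -> 0 <= C + q.+1%:R * b1 ->
  exists2 g, 0 <= g & forall b2, 0 <= C + q.+1%:R * b2 ->
    psi q.+1 b1 ((C + q.+1%:R * b1) / q.+2%:R) + g * (b2 - b1) <=
    psi q.+1 b2 ((C + q.+1%:R * b2) / q.+2%:R).
Proof.
move=> C0; have q2 : 0 < q.+2%:R :> R by rewrite ltr0n.
pose av b := (C + q.+1%:R * b) / q.+2%:R.
have avE b : q.+2%:R * av b = C + q.+1%:R * b by rewrite /av mulrC divfK ?gt_eqF.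
have avle b : (b <= av b) = (b <= C).
  rewrite ler_pdivlMr // -[q.+2%:R]natr1 mulrDr mulr1 addrC mulrC.
  by rewrite lerD2r.
have avge b : (av b <= b) = (C <= b).
  rewrite ler_pdivrMr // -[q.+2%:R]natr1 mulrDr mulr1 addrC [b * _]mulrC.
  by rewrite lerD2l.
have avC b : (av b <= C) = (b <= C).
  rewrite ler_pdivrMr // -[q.+2%:R]natr1 mulrDr mulr1 addrC [C * _]mulrC.
  by rewrite lerD2r ler_pM2l ?ltr0n.
have psiC b : C <= b -> psi q.+1 b (av b) = C * b ^+ q.+1.
  move=> Cb; rewrite psi_le ?avge // /tang avE; ring.
have psia b : b <= C -> psi q.+1 b (av b) = av b ^+ q.+2.
  by move=> bC; rewrite psi_ge ?avle.
rewrite -/(av _) => a10; have {a10} a10 : 0 <= av b1 by rewrite divr_ge0.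
have [bC1|bC1] := leP b1 C.
- exists (q.+1%:R * av b1 ^+ q.+1); first by rewrite mulr_ge0 ?exprn_ge0.
  move=> b2; rewrite -/(av _) => a20; have {a20} a20 : 0 <= av b2 by rewrite divr_ge0.
  rewrite (psia b1) //.
  have -> : av b1 ^+ q.+2 + q.+1%:R * av b1 ^+ q.+1 * (b2 - b1) =
      av b1 ^+ q.+1 * (q.+2%:R * av b2 - q.+1%:R * av b1).
    have -> : q.+2%:R * av b2 = q.+2%:R * av b1 + q.+1%:R * (b2 - b1).
      by rewrite !avE; ring.
    by rewrite [_ ^+ q.+2]exprS -[q.+2%:R]natr1; ring.
  have [bC2|bC2] := leP b2 C; first by rewrite psia // tang_le.
  rewrite psiC ?(ltW bC2) //.
  have a1C : av b1 <= C by rewrite avC.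
  have H : tang q (av b1) b2 <= b2 ^+ q.+1.
    by apply: tang_le => //; exact: le_trans (ltW bC2).
  (* The points lie on different branches; the tangent of the lower power at [av b1], scaled by [C],
     separates the two sides. *)
  apply: (@le_trans _ _ (C * tang q (av b1) b2)); last by rewrite ler_wpM2l.
  rewrite avE -subr_ge0.
  have -> : C * tang q (av b1) b2 -
      av b1 ^+ q.+1 * (C + q.+1%:R * b2 - q.+1%:R * av b1) =
      av b1 ^+ q * (q.+1%:R * ((C - av b1) * (b2 - av b1))).
    by rewrite /tang exprS -natr1; ring.
  rewrite mulr_ge0 ?exprn_ge0 // mulr_ge0 // mulr_ge0 // subr_ge0 //.
  exact: le_trans a1C (ltW bC2).
- exists (q.+1%:R * (C * b1 ^+ q)).
    by rewrite mulr_ge0 // mulr_ge0 // exprn_ge0 // (le_trans C0) // ltW.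
  move=> b2; rewrite -/(av _) => a20; have {a20} a20 : 0 <= av b2 by rewrite divr_ge0.
  have b10 : 0 <= b1 by rewrite (le_trans C0) // ltW.
  rewrite (psiC b1) ?(ltW bC1) //.
  have -> : C * b1 ^+ q.+1 + q.+1%:R * (C * b1 ^+ q) * (b2 - b1) = C * tang q b1 b2.
    by rewrite /tang exprS -natr1; ring.
  have [bC2|bC2] := leP b2 C; last first.
    by rewrite psiC ?(ltW bC2) // ler_wpM2l // tang_le // (le_trans C0) // ltW.
  (* [C * tang q C b2] is also the tangent of the next power at [C], evaluated at [av b2]. *)
  rewrite psia //; apply: (@le_trans _ _ (C * tang q C b2)).
    by rewrite ler_wpM2l // tang_anti // ltW.
  apply: le_trans (tang_le q.+1 _ _ C0 a20).
  by rewrite /tang avE exprS -natr1 le_eqVlt; apply/orP; left; apply/eqP; ring.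
Qed.

End Psi.

(* Uncovered fraction when [o] and [t] are the (normalised) numbers of chosen
   hidden and other elements; [d] is the width of the zone where only [o + t]
   matters.  For [q = 0] the division by zero is harmless: [psi 0 b a = a]. *)
Definition hid {R : realFieldType} (q : nat) (d o t : R) : R :=
  psi q (1 - (t + d) / q%:R) (1 - (o + t) / q.+1%:R).

(** * Monotonicity and second differences of the uncovered fraction *)

Section Hidden.
Context {R : realFieldType}.
Implicit Types (d o t e : R) (q : nat).

Lemma psi0E (b a : R) : psi 0 b a = a.
Proof. by rewrite /psi /tang expr0 !mul1r mul0r subr0. Qed.

Lemma hid_arg_ge0 q o t : o + t <= q.+1%:R -> 0 <= 1 - (o + t) / q.+1%:R :> R.
Proof. by move=> ?; rewrite subr_ge0 ler_pdivrMr ?ltr0n // mul1r. Qed.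

(** Hidden elements exceed their proportional share by at most [d]. For [q > 0] this is precisely
    the condition that puts [psi] on its power branch, where only [o + t] shows. *)
Lemma hid_balanced q d o t : o <= (o + t) / q.+1%:R + d ->
  hid q d o t = (1 - (o + t) / q.+1%:R) ^+ q.+1.
Proof.
case: q => [|q] H; first by rewrite /hid psi0E expr1.
have q1 : 0 < q.+1%:R :> R by rewrite ltr0n.
rewrite /hid psi_ge // lerD2l lerN2 ler_pdivlMr //.
have q2 : 0 < q.+2%:R :> R by rewrite ltr0n.
set v := _ / _ in H *.
have vE : o + t = v * q.+1%:R + v.
  have <- : q.+2%:R * v = v * q.+1%:R + v by rewrite -[q.+2%:R]natr1; ring.
  by rewrite /v mulrC divfK // gt_eqF.
by lra.
Qed.

(** The shape required by [psi_subgradient_diag]: for fixed [o], only [b] moves with [t]. In the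
    remaining case [q = 0], [hid] is affine. *)
Lemma hidS q d o t : hid q.+1 d o t =
  let C := 1 - o + d in let b := 1 - (t + d) / q.+1%:R in
  psi q.+1 b ((C + q.+1%:R * b) / q.+2%:R).
Proof.
rewrite /hid /=; congr psi; rewrite -[q.+2%:R]natr1.
have q1 : 0 <= q%:R :> R by [].
rewrite -[q.+1%:R]natr1.
by field; rewrite !gt_eqF //; lra.
Qed.

Lemma hid_ge0 q d o t : 0 <= d -> o <= 1 -> o + t <= q.+1%:R -> 0 <= hid q d o t.
Proof.
case: q => [|q] d0 o1 H.
  by rewrite /hid psi0E hid_arg_ge0.
have := hid_arg_ge0 q.+1 o t H; rewrite /hid.
set a := 1 - (o + t) / _; set b := 1 - _ / _ => a0.
have [ab|ab] := leP a b; last by rewrite psi_ge ?exprn_ge0 // ltW.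
rewrite psi_le // mulr_ge0 //; first by rewrite exprn_ge0 // (le_trans a0).
have -> : q.+2%:R * a - q.+1%:R * b = 1 - o + d; last by rewrite addr_ge0 ?subr_ge0.
have q1 : 0 <= q%:R :> R by [].
rewrite /a /b -[q.+2%:R]natr1 -[q.+1%:R]natr1.
by field; rewrite !gt_eqF //; lra.
Qed.

(** For [q > 0], [d <= b] puts [psi] on its tangent branch, whose second factor collapses to [d]. *)
Lemma hid_opt q d : 0 <= d -> d <= 1 / 2 -> hid q d 1 0 <= d.
Proof.
case: q => [|q] d0 d1; first by rewrite /hid psi0E addr0 divr1 subrr.
have q1 : 0 <= q%:R :> R by [].
have q2 : 0 < q.+1%:R :> R by rewrite ltr0n.
rewrite hidS /= subrr !add0r; set b := 1 - _.
have b0 : d <= b.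
  by rewrite lerBrDl -lerBrDr ler_pdivrMr // -[q.+1%:R]natr1; nra.
have b1 : b <= 1 by rewrite gerBl divr_ge0 // ltW.
clearbody b; rewrite psi_le; last first.
  by rewrite ler_pdivrMr ?ltr0n // -[q.+2%:R]natr1; lra.
rewrite /tang [_ * (_ / _)]mulrC divfK ?gt_eqF ?ltr0n // addrK.
by rewrite ler_piMl // exprn_ile1 // (le_trans d0).
Qed.

Lemma hid0 q d : 0 <= d -> hid q d 0 0 = 1.
Proof.
by move=> d0; rewrite hid_balanced addr0 mul0r ?add0r // subr0 expr1n.
Qed.

Lemma hid_le_o q d o t e : 0 <= e -> o + e + t <= q.+1%:R ->
  hid q d (o + e) t <= hid q d o t.
Proof.
move=> e0 H; rewrite /hid; set b := 1 - (t + d) / _.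
have q1 : 0 < q.+1%:R :> R by rewrite ltr0n.
have H' : o + t <= q.+1%:R by lra.
have := psi_subgradient q b _ _ (hid_arg_ge0 _ _ _ H) (hid_arg_ge0 _ _ _ H').
apply: le_trans; rewrite lerDl mulr_ge0 //.
  rewrite mulr_ge0 // exprn_ge0 // le_max hid_arg_ge0 //.
by rewrite opprB addrC subrKA -mulrBl divr_ge0 //; lra.
Qed.

Lemma hid_oo q d o t e : 0 <= e -> o + e + e + t <= q.+1%:R ->
  hid q d (o + e) t + hid q d (o + e) t <= hid q d o t + hid q d (o + e + e) t.
Proof.
move=> e0 H; rewrite /hid; set b := 1 - (t + d) / _.
have q1 : 0 < q.+1%:R :> R by rewrite ltr0n.
have H1 : o + e + t <= q.+1%:R by lra.
have H0 : o + t <= q.+1%:R by lra.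
have := psi_subgradient q b _ _ (hid_arg_ge0 _ _ _ H1) (hid_arg_ge0 _ _ _ H0).
have := psi_subgradient q b _ _ (hid_arg_ge0 _ _ _ H1) (hid_arg_ge0 _ _ _ H).
set a1 := 1 - (o + e + t) / _.
have -> : 1 - (o + t) / q.+1%:R - a1 = e / q.+1%:R by rewrite /a1 !mulrDl; ring.
have -> : 1 - (o + e + e + t) / q.+1%:R - a1 = - (e / q.+1%:R).
  by rewrite /a1 !mulrDl; ring.
rewrite mulrN; move: (psi q b _) (_ * (e / _)) (psi q b _) (psi q b _) => x y z w; lra.
Qed.

(** Both single additions lead to the same argument [a1] and differ only in the threshold. Adding to
    [t] lowers the threshold, hence the slope at [a1], so the gain on one side outweighs the loss on
    the other. *)
Lemma hid_ot q d o t e : 0 <= e -> o + e + (t + e) <= q.+1%:R ->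
  hid q d (o + e) t + hid q d o (t + e) <= hid q d o t + hid q d (o + e) (t + e).
Proof.
move=> e0 H; rewrite /hid.
have bb : 1 - (t + e + d) / q%:R <= 1 - (t + d) / q%:R.
  by rewrite lerD2l lerN2 ler_wpM2r ?invr_ge0 //; lra.
move: bb; set b' := 1 - (t + e + d) / _; set b := 1 - (t + d) / _ => bb.
have q1 : 0 < q.+1%:R :> R by rewrite ltr0n.
have H1 : o + e + t <= q.+1%:R by lra.
have H0 : o + t <= q.+1%:R by lra.
have := psi_subgradient q b _ _ (hid_arg_ge0 _ _ _ H1) (hid_arg_ge0 _ _ _ H0).
have := psi_subgradient q b' _ _ (hid_arg_ge0 _ _ _ H1) (hid_arg_ge0 _ _ _ H).
have -> : o + (t + e) = o + e + t by ring.
have := hid_arg_ge0 _ _ _ H1.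
set a1 := 1 - (o + e + t) / _ => a10.
have -> : 1 - (o + t) / q.+1%:R - a1 = e / q.+1%:R by rewrite /a1 !mulrDl; ring.
have -> : 1 - (o + e + (t + e)) / q.+1%:R - a1 = - (e / q.+1%:R).
  by rewrite /a1 !mulrDl; ring.
have mm : Num.max a1 b' ^+ q <= Num.max a1 b ^+ q.
  apply: lerXn2r; rewrite ?nnegrE; [by rewrite le_max a10|by rewrite le_max a10|].
  by rewrite ge_max !le_max lexx /= bb orbT.
have : q.+1%:R * Num.max a1 b' ^+ q * (e / q.+1%:R) <=
   q.+1%:R * Num.max a1 b ^+ q * (e / q.+1%:R).
  by apply: ler_wpM2r; [rewrite divr_ge0 // ltW | rewrite ler_wpM2l // ltW].
rewrite mulrN; move: (psi q b _) (psi q b _) (psi q b' _) (psi q b' _).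
by move: (_ * (e / _)) (_ * (e / _)) => x y z w z' w'; lra.
Qed.

Lemma hid_diag q d o t :
  1 - o + d + q.+1%:R * (1 - (t + d) / q.+1%:R) = q.+2%:R - (o + t) :> R.
Proof.
have q1 : 0 <= q%:R :> R by [].
rewrite -[q.+2%:R]natr1 -[q.+1%:R]natr1.
by field; rewrite !gt_eqF //; lra.
Qed.

Lemma hid_le_t q d o t e : 0 <= e -> 0 <= d -> o <= 1 -> o + (t + e) <= q.+1%:R ->
  hid q d o (t + e) <= hid q d o t.
Proof.
case: q => [|q] e0 d0 o1 H; first by rewrite /hid !psi0E !divr1; lra.
rewrite !hidS /=.
have C0 : 0 <= 1 - o + d by lra.
have H0 : 0 <= 1 - o + d + q.+1%:R * (1 - (t + d) / q.+1%:R).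
  by rewrite hid_diag; lra.
have H1 : 0 <= 1 - o + d + q.+1%:R * (1 - (t + e + d) / q.+1%:R).
  by rewrite hid_diag; lra.
have [g g0 /(_ _ H0)] := psi_subgradient_diag q _ _ C0 H1.
apply: le_trans; rewrite lerDl mulr_ge0 //.
by rewrite opprB addrC subrKA -mulrBl divr_ge0 //; lra.
Qed.

Lemma hid_tt q d o t e : 0 <= e -> 0 <= d -> o <= 1 -> o + (t + e + e) <= q.+1%:R ->
  hid q d o (t + e) + hid q d o (t + e) <= hid q d o t + hid q d o (t + e + e).
Proof.
case: q => [|q] e0 d0 o1 H; first by rewrite /hid !psi0E !divr1; lra.
rewrite !hidS /=.
have C0 : 0 <= 1 - o + d by lra.
have H0 : 0 <= 1 - o + d + q.+1%:R * (1 - (t + d) / q.+1%:R).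
  by rewrite hid_diag; lra.
have H1 : 0 <= 1 - o + d + q.+1%:R * (1 - (t + e + d) / q.+1%:R).
  by rewrite hid_diag; lra.
have H2 : 0 <= 1 - o + d + q.+1%:R * (1 - (t + e + e + d) / q.+1%:R).
  by rewrite hid_diag; lra.
have [g g0 I] := psi_subgradient_diag q _ _ C0 H1.
move: (I _ H0) (I _ H2).
set b1 := 1 - (t + e + d) / _.
have -> : 1 - (t + d) / q.+1%:R - b1 = e / q.+1%:R by rewrite /b1 !mulrDl; ring.
have -> : 1 - (t + e + e + d) / q.+1%:R - b1 = - (e / q.+1%:R).
  by rewrite /b1 !mulrDl; ring.
rewrite mulrN; move: (_ * (e / _)) (psi _ _ _) (psi _ _ _) (psi _ _ _).
by move=> x y z w; lra.
Qed.
End Hidden.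

(** * Submodular functions of two counts *)

Section LocalSubmodularity.
Context {R : realType} {n : nat}.
Implicit Types (f : setfun R n) (A B S : {set 'I_n}).

Lemma local_monotone f :
  (forall S x, x \notin S -> f S <= f (x |: S)%SET) -> monotone_setfun f.
Proof.
move=> mf A B; move: {2}#|_| (erefl #|(B :\: A)%SET|) => k.
elim: k B => [|k IH] B kE AB.
  move/eqP: kE; rewrite cards_eq0 finset.setD_eq0 => BA.
  by rewrite (_ : B = A) //; apply/eqP; rewrite finset.eqEsubset BA.
have /card_gt0P[y] : (0 < #|(B :\: A)%SET|)%N by rewrite kE.
rewrite inE => /andP[yA yB].
apply: le_trans (_ : f (B :\ y)%SET <= _).
  apply: IH; last by rewrite finset.subsetD1 AB.
  move: kE; rewrite (cardsD1 y (B :\: A)%SET) inE yA yB add1n => -[<-].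
  by apply: eq_card => z; rewrite !inE andbCA.
by rewrite -[in leRHS](finset.setD1K yB) mf // !inE eqxx.
Qed.

(** Growing [B] one element at a time gives diminishing returns for [A \subset B]; a second
    induction, on [A :\: B], sums these inequalities. *)
Lemma local_submodular f :
  (forall S x y, x \notin S -> y \notin S -> x != y ->
    f (x |: (y |: S))%SET + f S <= f (x |: S)%SET + f (y |: S)%SET) ->
  submodular f.
Proof.
move=> sf.
have DR A B x : A \subset B -> x \notin B ->
    f (x |: B)%SET + f A <= f (x |: A)%SET + f B.
  move: {2}#|_| (erefl #|(B :\: A)%SET|) => k.
  elim: k B => [|k IH] B kE AB xB.
    move/eqP: kE; rewrite cards_eq0 finset.setD_eq0 => BA.
    by rewrite (_ : B = A) //; apply/eqP; rewrite finset.eqEsubset BA.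
  have /card_gt0P[y] : (0 < #|(B :\: A)%SET|)%N by rewrite kE.
  rewrite inE => /andP[yA yB].
  have xB' : x \notin (B :\ y)%SET by rewrite inE (negbTE xB) andbF.
  have xy : x != y by apply: contraNneq xB => ->.
  have := IH (B :\ y)%SET _ _ xB'.
  have -> : #|((B :\ y) :\: A)%SET| = k.
    move: kE; rewrite (cardsD1 y (B :\: A)%SET) inE yA yB add1n => -[<-].
    by apply: eq_card => z; rewrite !inE andbCA.
  rewrite finset.subsetD1 AB yA => /(_ erefl isT) I1.
  have := sf (B :\ y)%SET x y xB' _ xy; rewrite (finset.setD1K yB).
  by rewrite !inE eqxx => /(_ isT) I2; lra.
move=> A B; move: {2}#|_| (erefl #|(A :\: B)%SET|) => k.
elim: k A => [|k IH] A kE.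
  move/eqP: kE; rewrite cards_eq0 finset.setD_eq0 => AB.
  by rewrite (finset.setUidPr AB) (finset.setIidPl AB) addrC.
have /card_gt0P[y] : (0 < #|(A :\: B)%SET|)%N by rewrite kE.
rewrite inE => /andP[yB yA].
have := IH (A :\ y)%SET.
have -> : #|((A :\ y) :\: B)%SET| = k.
  move: kE; rewrite (cardsD1 y (A :\: B)%SET) inE yA yB add1n => -[<-].
  by apply: eq_card => z; rewrite !inE andbCA.
have -> : ((A :\ y) :&: B = A :&: B)%SET.
  apply/setP => z; rewrite !inE; case: eqP => // ->.
  by rewrite (negbTE yB) !andbF.
move=> /(_ erefl) I1.
have := DR (A :\ y)%SET ((A :\ y) :|: B)%SET y (finset.subsetUl _ _).
rewrite !inE eqxx (negbTE yB) => /(_ isT).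
by rewrite finset.setUA !(finset.setD1K yA) => I2; lra.
Qed.

End LocalSubmodularity.

(** * Coverage of one class as a set function *)

Section Part.
Context {R : realType} {n : nat}.
Implicit Types (S P Q : {set 'I_n}).

(** [P] holds the hidden elements of a class, [Q] the others, and [K] counts its groups. For [K = 0]
    both quotients are 0, so the value is 0 when [0 <= d]. *)
Definition part (q : nat) (d : R) (K : nat) P Q : setfun R n := fun S =>
  1 - hid q d (#|(S :&: P)%SET|%:R / K%:R) (#|(S :&: Q)%SET|%:R / K%:R).

Context (q K : nat) (d : R) (P Q : {set 'I_n}).
Hypotheses (d0 : 0 <= d) (PQ : forall x, x \in P -> (x \in Q) = false) (PK : (#|P| <= K)%N)
  (PQK : (#|P| + #|Q| <= q.+1 * K)%N).

Local Notation o S := (#|(S :&: P)%SET|%:R / K%:R : R).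
Local Notation t S := (#|(S :&: Q)%SET|%:R / K%:R : R).

Let natr_div_le (a b : nat) : (a <= b * K)%N -> a%:R / K%:R <= b%:R :> R.
Proof.
case: K => [|k] H; first by rewrite invr0 mulr0.
by rewrite ler_pdivrMr ?ltr0n // -natrM ler_nat.
Qed.

Lemma part_o_le1 S : o S <= 1.
Proof.
apply: (natr_div_le _ 1); rewrite mul1n (leq_trans _ PK) //.
exact/subset_leq_card/finset.subsetIr.
Qed.

Lemma part_sum_le S : o S + t S <= q.+1%:R.
Proof.
rewrite -mulrDl -natrD; apply: natr_div_le; rewrite (leq_trans _ PQK) // leq_add //.
  exact/subset_leq_card/finset.subsetIr.
exact/subset_leq_card/finset.subsetIr.
Qed.

Lemma card_U1I S (X : {set 'I_n}) x : x \notin S ->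
  #|((x |: S) :&: X)%SET| = (#|(S :&: X)%SET| + (x \in X))%N.
Proof.
move=> xS; rewrite finset.setIUl cardsU.
have -> : ([set x] :&: X :&: (S :&: X) = finset.set0)%SET.
  apply/setP => z; rewrite !inE; case: eqP => // ->.
  by rewrite (negbTE xS) /= andbF.
rewrite cards0 subn0 addnC; congr addn.
case: (boolP (x \in X)) => xX.
  rewrite (finset.setIidPl _) ?cards1 //.
  by apply/fintype.subsetP => z; rewrite inE => /eqP->.
apply/eqP; rewrite cards_eq0; apply/eqP/setP => z; rewrite !inE.
by case: eqP => // ->; rewrite (negbTE xX).
Qed.

Let e : R := K%:R^-1.
Let e0 : 0 <= e. Proof. by rewrite invr_ge0. Qed.

Let addE (k : nat) (b : bool) : (k + b)%:R / K%:R = k%:R / K%:R + b%:R * e.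
Proof. by rewrite natrD mulrDl. Qed.

Lemma part_monotone : monotone_setfun (part q d K P Q).
Proof.
apply: local_monotone => S x xS; rewrite /part lerD2l lerN2.
have := part_o_le1 (x |: S)%SET; have := part_sum_le (x |: S)%SET.
have := part_o_le1 S.
rewrite !card_U1I // !addE; have := PQ x.
case: (x \in P) => [/(_ isT)->|_]; rewrite !(mul0r, mul1r, addr0) => H1 H2 H3.
  exact: hid_le_o.
case: (x \in Q) H2 => H2; rewrite !(mul0r, mul1r, addr0) in H2 *; last by [].
exact: hid_le_t.
Qed.

(** Two hidden elements, a mixed pair and two other elements correspond to [hid_oo], [hid_ot] and
    [hid_tt]. *)
Lemma part_submodular : submodular (part q d K P Q).
Proof.
apply: local_submodular => S x y xS yS xy; rewrite /part.
have := part_o_le1 (x |: (y |: S))%SET; have := part_sum_le (x |: (y |: S))%SET.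
have xyS : x \notin (y |: S)%SET by rewrite !inE negb_or xy.
have := part_o_le1 S.
rewrite !card_U1I // !addE.
have := PQ x; have := PQ y.
set o := _ / _; set t := _ / _.
case: (x \in P) => Py; case: (y \in P) Py => Py;
 [have -> := Py isT; move=> /(_ isT)-> | move=> /(_ isT)->
 | have -> := Py isT; move=> _ | move=> _];
 rewrite ?(mul0r, mul1r, addr0) => o1 H1 H2.
- by have := hid_oo q d o t _ e0 H1; lra.
- case: (y \in Q) H1 => H1; rewrite !(mul0r, mul1r, addr0) in H1 *; last by lra.
  by have := hid_ot q d o t _ e0 H1; lra.
- case: (x \in Q) H1 => H1; rewrite !(mul0r, mul1r, addr0) in H1 *; last by lra.
  by have := hid_ot q d o t _ e0 H1; lra.
- case: (x \in Q) H1; case: (y \in Q) => H1; rewrite ?(mul0r, mul1r, addr0) in H1 *;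
    try lra.
  by have := hid_tt q d o t _ e0 d0 o1 H1; lra.
Qed.

Lemma part_nonneg : nonneg_setfun (part q d K P Q).
Proof.
move=> S; apply: le_trans (part_monotone finset.set0 S (finset.sub0set S)).
by rewrite /part !finset.set0I cards0 mul0r hid0 // subrr.
Qed.

Lemma part_le1 S : part q d K P Q S <= 1.
Proof. by rewrite gerBl hid_ge0 ?part_o_le1 ?part_sum_le. Qed.

End Part.

(** * Random hidden sets *)

Section Concentration.
Context {R : realType}.

(** Inverts [1 - x <= expR (- x)], using [(1 + x + 2x^2)(1 - x) = 1 + x^2 (1 - 2x)]. *)
Lemma expR_le_quad (x : R) : 0 <= x -> x <= 1 / 2 -> expR x <= 1 + x + 2 * x ^+ 2.
Proof.
move=> x0 x1.
have e0 : 0 < expR (- x) by exact: expR_gt0.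
have e1 : 1 - x <= expR (- x) by exact: expR_ge1Dx.
have E : expR x * expR (- x) = 1 by rewrite -expRD subrr expR0.
rewrite -(ler_pM2r e0) E.
apply: (@le_trans _ _ ((1 + x + 2 * x ^+ 2) * (1 - x))); first by nra.
by apply: ler_wpM2l => //; nra.
Qed.

(** The exponential moment method in counting form: a uniform [f] makes independent choices [f g],
    and [w g] marks the successful ones. *)
Lemma chernoff (k m : nat) (w : 'I_k -> 'I_m.+1 -> bool) (tau : R) :
  0 <= tau -> tau <= 2 ->
  #|[set f : {ffun 'I_k -> 'I_m.+1} |
     (\sum_g \sum_i w g i)%:R / m.+1%:R + tau * k%:R < (\sum_g w g (f g))%:R]%SET|%:R
  <= (m.+1 ^ k)%:R * expR (- (tau ^+ 2 / 8 * k%:R)) :> R.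
Proof.
move=> t0 t2; pose x g : R := (\sum_i w g i)%:R / m.+1%:R.
have m1 : 0 < m.+1%:R :> R by rewrite ltr0n.
(* The parameter [tau / 4] is at most 1/2, as the quadratic bound requires, and leaves the exponent
   [tau^2/8 - tau^2/4] per group. *)
pose F g i : R := expR (tau / 4 * ((w g i)%:R - x g - tau)).
have x0 g : 0 <= x g by rewrite divr_ge0.
have xm g : x g * m.+1%:R = (\sum_i w g i)%:R by rewrite divfK ?gt_eqF.
have x1 g : x g <= 1.
  rewrite ler_pdivrMr // mul1r ler_nat -[leqRHS]card_ord -sum1_card leq_sum //.
  by move=> i _; case: (w g i).
have Fsum g : \sum_i F g i <= m.+1%:R * expR (- (tau ^+ 2 / 8)).
  have -> : \sum_i F g i = m.+1%:R *
      ((1 + x g * (expR (tau / 4) - 1)) * expR (- (tau / 4 * (x g + tau)))).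
    have -> : m.+1%:R * ((1 + x g * (expR (tau / 4) - 1)) *
          expR (- (tau / 4 * (x g + tau)))) =
        (m.+1%:R + (x g * m.+1%:R) * (expR (tau / 4) - 1)) *
          expR (- (tau / 4 * (x g + tau))) by ring.
    rewrite xm natr_sum mulr_suml -[X in X%:R + _](card_ord m.+1) -sum1_card natr_sum.
    rewrite -big_split /= mulr_suml; apply: eq_bigr => i _; rewrite /F.
    case: (w g i); rewrite /= ?mulr1n ?mulr0n ?mul1r ?mul0r.
      by rewrite [1 + (_ - 1)]addrC subrK -expRD; congr expR; ring.
    by rewrite addr0 mul1r; congr expR; ring.
  rewrite ler_pM2l //.
  have E1 : 1 + x g * (expR (tau / 4) - 1) <= expR (x g * (expR (tau / 4) - 1)).
    exact: expR_ge1Dx.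
  apply: (le_trans (ler_wpM2r (expR_ge0 _) E1)).
  rewrite -expRD ler_expR.
  have : expR (tau / 4) <= 1 + tau / 4 + 2 * (tau / 4) ^+ 2.
    by apply: expR_le_quad; lra.
  have := x0 g; have := x1 g; nra.
apply: (@le_trans _ _ (\sum_(f : {ffun 'I_k -> 'I_m.+1}) \prod_g F g (f g))).
  rewrite -sum1_card natr_sum big_mkcond /=; apply: ler_sum => f _.
  rewrite inE; case: ifP => [H|_]; last by apply: prodr_ge0 => g _; exact: expR_ge0.
  rewrite -expR_sum -mulr_sumr -[leLHS]expR0 ler_expR mulr_ge0 ?divr_ge0 //.
  rewrite !sumrB sumr_const card_ord -mulr_natr.
  rewrite [(\sum_g \sum_i w g i)%:R]natr_sum mulr_suml natr_sum in H.
  by rewrite -addrA -opprD subr_ge0 ltW.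
(* Independence: the sum over choice functions of a product is a product of sums. *)
rewrite -bigA_distr_bigA /=.
have -> : (m.+1 ^ k)%:R * expR (- (tau ^+ 2 / 8 * k%:R)) =
    \prod_(g < k) (m.+1%:R * expR (- (tau ^+ 2 / 8))) :> R.
  by rewrite prodr_const card_ord exprMn natrX -expRM_natr mulNr.
by apply: ler_prod => g _; rewrite Fsum sumr_ge0 // => i _; exact: expR_ge0.
Qed.

End Concentration.

(** * One hidden element per group *)

Section HiddenSet.
Context {R : realType} {n k m : nat}.
Variables (D : {set 'I_n}) (h : 'I_n -> 'I_k * 'I_m.+1).
Hypothesis hI : {in D &, injective h}.
Implicit Types (S : {set 'I_n}) (f : {ffun 'I_k -> 'I_m.+1}).

(** [h] gives the group and the slot of an element; [f] picks one slot in each group. *)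
Definition hidden_set f : {set 'I_n} := [set e in D | f (h e).1 == (h e).2]%SET.

Let w S g i := (g, i) \in [set h e | e in S :&: D]%SET.

Let card_image S : S \subset D -> #|S| = (\sum_g \sum_i w S g i)%N.
Proof.
move=> SD; rewrite pair_bigA /= -(@card_in_imset _ _ h S); last first.
  by move=> x y /(fintype.subsetP SD) xD /(fintype.subsetP SD) yD; exact: hI.
rewrite -sum1_card big_mkcond; apply: eq_bigr => -[g i] _.
by rewrite /w (finset.setIidPl SD); case: (_ \in _).
Qed.

Lemma card_hidden_set S f :
  #|(S :&: hidden_set f)%SET| = (\sum_g w S g (f g))%N.
Proof.
rewrite card_image; last first.
  by apply/fintype.subsetP => x; rewrite !inE => /andP[_ /andP[]].
apply: eq_bigr => g _; rewrite (bigD1 (f g)) //= big1 ?addn0.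
  congr nat_of_bool; apply/imsetP/imsetP => -[x].
    by rewrite !inE => /andP[/andP[xS /andP[xD _]] _] E; exists x; rewrite ?inE ?xS.
  rewrite !inE => /andP[xS xD] E; exists x => //.
  by rewrite !inE xS xD -E /= eqxx.
move=> i fi; apply/eqP; rewrite eqb0; apply/negP => /imsetP[x].
rewrite !inE => /andP[/andP[xS /andP[xD H]] _] E.
by move: H fi; rewrite -E /= eq_sym => ->.
Qed.

Lemma card_hidden_class S : #|(S :&: D)%SET| = (\sum_g \sum_i w S g i)%N.
Proof.
rewrite card_image ?finset.subsetIr //; apply: eq_bigr => g _; apply: eq_bigr => i _.
by rewrite /w -finset.setIA finset.setIid.
Qed.

Lemma hidden_set_chernoff S (tau : R) : 0 <= tau -> tau <= 2 ->
  #|[set f | #|(S :&: D)%SET|%:R / m.+1%:R + tau * k%:R <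
     #|(S :&: hidden_set f)%SET|%:R]%SET|%:R
  <= (m.+1 ^ k)%:R * expR (- (tau ^+ 2 / 8 * k%:R)) :> R.
Proof.
move=> t0 t2; rewrite card_hidden_class; have := chernoff k m (w S) tau t0 t2.
congr (_ <= _); congr _%:R; apply: eq_card => f; rewrite !inE.
by rewrite card_hidden_set.
Qed.

Variable G : {set 'I_k}.
Hypothesis hD : [set h e | e in D]%SET = finset.setX G finset.setT.

Lemma card_hidden_setE f : #|hidden_set f| = #|G|.
Proof.
rewrite -[hidden_set f]finset.setTI card_hidden_set -sum1_card [RHS]big_mkcond /=.
apply: eq_bigr => g _; rewrite /w finset.setTI hD !inE andbT.
by case: (_ \in _).
Qed.

Lemma card_hidden_classE : #|D| = (m.+1 * #|G|)%N.
Proof.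
by rewrite -(card_in_imset hI) hD cardsX cardsT card_ord mulnC.
Qed.

End HiddenSet.

(** * Query traces *)

Section Oracle.
Context {R : realType} {n : nat}.
Implicit Types (f : setfun R n) (A : qalg R n).

(** The output counts as a last query because its value must be controlled too. *)
Fixpoint trace f A : seq {set 'I_n} :=
  match A with
  | QOut X => [:: X]
  | QAsk X k => X :: trace f (k (f X))
  end.

Lemma size_trace f A : size (trace f A) = (nqueries f A).+1.
Proof. by elim: A => //= X k IH; rewrite IH. Qed.

Lemma qout_trace f A : qout f A \in trace f A.
Proof.
elim: A => [X|X k IH] /=; first by rewrite inE.
by rewrite inE IH orbT.
Qed.

Lemma qout_eq_trace f g A :
  {in trace f A, g =1 f} -> qout g A = qout f A.
Proof.
elim: A => //= X k IH fg.
rewrite /qout /= (fg X) ?mem_head //.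
by apply: IH => S ST; apply: fg; rewrite inE ST orbT.
Qed.

End Oracle.

(** * The saddle point *)

Section Game.
Context {R : realType}.
Implicit Types (c r x y p : R).

(** The tangent with its value factored out: at the saddle point both classes share this factor. *)
Lemma pow_tangent q (u v : R) : 0 <= u -> 0 < v ->
  v ^+ q.+1 * (1 + q.+1%:R * (u - v) / v) <= u ^+ q.+1.
Proof.
move=> u0 v0; apply: le_trans (tang_le q v u (ltW v0) u0).
rewrite le_eqVlt; apply/orP; left; apply/eqP.
rewrite /tang exprS -natr1; field; exact: lt0r_neq0.
Qed.

(* [q.+1] is the paper's [s]; the number of groups of size [s], resp. [s+1], is
   [((s+1) c - 1) n], resp. [(1 - s c) n]. *)
Lemma rho_game c r : 0 < c -> is_rho c r -> exists q p,
  [/\ 0 <= p <= 1, 0 < r, q.+1%:R * c <= 1, 1 < q.+2%:R * c &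
      (q.+1%:R * c = 1 -> p = 1)] /\
  forall x y : R, 0 <= x <= 1 -> 0 <= y <= 1 ->
    (q.+2%:R * c - 1) * (q.+1%:R * x) + (1 - q.+1%:R * c) * (q.+2%:R * y) <= c ->
    p * (1 - (1 - x) ^+ q.+1) + (1 - p) * (1 - (1 - y) ^+ q.+2) <= r.
Proof.
move=> c0 [[[|q] [// _ cE rE]]|[[|q] [al [// _ /andP[c1 c2] /andP[al0 al1] sE rE]]]].
  have q1 : 0 < q.+1%:R :> R by rewrite ltr0n.
  have qc : q.+1%:R * c = 1 by rewrite cE divff // gt_eqF.
  have c1 : c <= 1 by rewrite cE invf_le1 // ler1n.
  have q2E : q.+2%:R * c = 1 + c by rewrite -natr1 mulrDl qc mul1r.
  (* For [c = 1/s] there are no groups of size [s+1], so the first class gets all the weight. *)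
  exists q, 1; split; first split; rewrite ?ler01 ?lexx ?qc //.
    rewrite rE subr_gt0; apply: (@le_lt_trans _ _ (1 - c)); last by rewrite gtrBl.
    by rewrite exprS ler_piMr ?subr_ge0 // exprn_ile1 ?subr_ge0 // gerBl ltW.
    by rewrite q2E ltrDl.
  move=> x y /andP[x0 x1] _.
  rewrite q2E subrr !mul0r !addr0 mul1r rE addrAC subrr add0r => H.
  rewrite lerD2l lerN2 lerXn2r ?nnegrE ?subr_ge0 // lerD2l lerN2.
  by move: H; rewrite mulrA [c * _]mulrC qc mul1r.
have q1 : 0 < q.+1%:R :> R by rewrite ltr0n.
have q2 : 0 < q.+2%:R :> R by rewrite ltr0n.
have qc : q.+1%:R * c < 1 by move: c2; rewrite -[_^-1]mul1r ltr_pdivlMr // mulrC.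
have qc2 : 1 < q.+2%:R * c by move: c1; rewrite -[_^-1]mul1r ltr_pdivrMr // mulrC.
have c_lt1 : c < 1 by rewrite (lt_le_trans c2) // invf_le1 // ler1n.
pose u := 1 - al * c - (1 - al) / q.+1%:R.
pose v := 1 - al * c - (1 - al) / q.+2%:R.
have i1 : q.+1%:R^-1 <= 1 :> R by rewrite invf_le1 // ler1n.
have i2 : q.+2%:R^-1 <= 1 :> R by rewrite invf_le1 // ler1n.
have i10 : 0 < q.+1%:R^-1 :> R by rewrite invr_gt0.
have i20 : 0 < q.+2%:R^-1 :> R by rewrite invr_gt0.
have alc0 : 0 < al * c by rewrite mulr_gt0.
have alc1 : al * c < al by rewrite gtr_pMr.
have be1 : (1 - al) / q.+1%:R <= 1 - al by rewrite ler_piMr // subr_ge0 ltW.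
have be2 : (1 - al) / q.+2%:R <= 1 - al by rewrite ler_piMr // subr_ge0 ltW.
have be0 : 0 < (1 - al) / q.+1%:R by rewrite mulr_gt0 // subr_gt0.
have u0 : 0 < u.
  by rewrite /u; move: alc1 be1; move: (al * c) (_ / q.+1%:R) => A B; lra.
have u1 : u < 1.
  by rewrite /u; move: alc0 be0; move: (al * c) (_ / q.+1%:R) => A B; lra.
have v0 : 0 < v.
  by rewrite /v; move: alc1 be2; move: (al * c) (_ / q.+2%:R) => A B; lra.
have uv : u ^+ q.+1 = v ^+ q.+2 by exact: sE.
pose a := q.+2%:R * c - 1; pose b := 1 - q.+1%:R * c.
have a0 : 0 < a by rewrite subr_gt0.
have b0 : 0 < b by rewrite subr_gt0.
pose Z := a * u + b * v.
have Z0 : 0 < Z by rewrite addr_gt0 // mulr_gt0.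
have p1E : 1 - a * u / Z = b * v / Z by rewrite /Z; field; exact: lt0r_neq0.
(* Lagrange multipliers at the saddle point [1 - x = u], [1 - y = v] *)
exists q, (a * u / Z); split; first split => //.
- rewrite divr_ge0 ?mulr_ge0 ?(ltW a0) ?(ltW u0) ?(ltW Z0) //=.
  by rewrite -subr_ge0 p1E divr_ge0 ?mulr_ge0 ?(ltW b0) ?(ltW v0) ?(ltW Z0).
- rewrite rE subr_gt0 /sigma_fn -/u (@le_lt_trans _ _ u) //.
  by rewrite exprS ler_piMr ?(ltW u0) // exprn_ile1 ?(ltW u0) ?(ltW u1).
- exact: ltW.
- by move=> E; move: qc; rewrite E ltxx.
move=> x y /andP[x0 x1] /andP[y0 y1]; rewrite -/a -/b => H.
have Tx : u ^+ q.+1 * (1 + q.+1%:R * (1 - x - u) / u) <= (1 - x) ^+ q.+1.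
  by apply: pow_tangent; rewrite ?subr_ge0.
have Ty : u ^+ q.+1 * (1 + q.+2%:R * (1 - y - v) / v) <= (1 - y) ^+ q.+2.
  by rewrite uv; apply: pow_tangent; rewrite ?subr_ge0.
rewrite p1E rE /sigma_fn -/u.
suff L : u ^+ q.+1 <= a * u / Z * (1 - x) ^+ q.+1 + b * v / Z * (1 - y) ^+ q.+2.
  move: L; rewrite -p1E.
  move: (a * u / Z) ((1 - x) ^+ _) ((1 - y) ^+ _) (u ^+ _) => X W V U L; lra.
(* Both powers are bounded by tangents at the saddle point. Weights proportional to [a * u] and
   [b * v] cancel the denominators, so only the budget spent remains. *)
apply: (@le_trans _ _ (a * u / Z * (u ^+ q.+1 * (1 + q.+1%:R * (1 - x - u) / u)) +
   b * v / Z * (u ^+ q.+1 * (1 + q.+2%:R * (1 - y - v) / v)))); last first.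
  by rewrite lerD // ler_wpM2l // divr_ge0 ?(ltW Z0) ?mulr_ge0 // ltW.
have -> : a * u / Z * (u ^+ q.+1 * (1 + q.+1%:R * (1 - x - u) / u)) +
   b * v / Z * (u ^+ q.+1 * (1 + q.+2%:R * (1 - y - v) / v)) =
   u ^+ q.+1 * (1 + (a * (q.+1%:R * (1 - u)) + b * (q.+2%:R * (1 - v)) -
     (a * (q.+1%:R * x) + b * (q.+2%:R * y))) / Z).
  move: Z0; rewrite /Z => Z0.
  by field; rewrite !lt0r_neq0.
rewrite ler_pMr ?exprn_gt0 // lerDl divr_ge0 ?(ltW Z0) // subr_ge0.
(* The saddle point spends the budget exactly, since [a + b = c] and [(q+1) a + (q+2) b = 1]. *)
suff -> : a * (q.+1%:R * (1 - u)) + b * (q.+2%:R * (1 - v)) = c by [].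
rewrite /a /b /u /v.
have Q0 : 0 <= q%:R :> R by [].
rewrite -[q.+2%:R]natr1 -[q.+1%:R]natr1.
by field; rewrite !gt_eqF //; lra.
Qed.

End Game.

(** * The hard instance *)

Section Classes.
Context {n k : nat}.
Hypothesis k0 : (0 < k)%N.

(** Elements are dealt to the groups in rotation: the remainder modulo [k] is the group, the
    quotient the slot. *)
Definition grp (e : 'I_n) : 'I_k := Ordinal (ltn_pmod e k0).
Definition cls (G : {set 'I_k}) : {set 'I_n} := [set e | grp e \in G]%SET.
Definition slot (m : nat) (e : 'I_n) : 'I_k * 'I_m.+1 := (grp e, inord (e %/ k)).

Section Slot.
Variables (m : nat) (G : {set 'I_k}).
Hypothesis Gm : forall e : 'I_n, grp e \in G -> (e %/ k <= m)%N.

Lemma slot_inj : {in cls G &, injective (slot m)}.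
Proof.
move=> x y; rewrite !inE => /Gm xm /Gm ym [E1 /(congr1 val)].
rewrite /= !inordK ?ltnS // => E2; apply: val_inj => /=.
by rewrite (divn_eq x k) (divn_eq y k) E1 E2.
Qed.

Lemma slot_onto : (forall g : 'I_k, g \in G -> (m * k + g < n)%N) ->
  [set slot m e | e in cls G]%SET = finset.setX G finset.setT.
Proof.
move=> Gn; apply/setP => -[g i]; rewrite !inE andbT.
apply/imsetP/idP => [[e]|gG]; first by rewrite inE => eG [-> _].
have ltn : (i * k + g < n)%N.
  apply: leq_ltn_trans (Gn g gG).
  by rewrite leq_add2r leq_mul2r -ltnS ltn_ord orbT.
have grpE : grp (Ordinal ltn) = g.
  by apply: val_inj; rewrite /= modnMDl modn_small.
exists (Ordinal ltn); first by rewrite inE grpE.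
rewrite /slot grpE /= divnMDl // divn_small // addn0.
by congr pair; apply: val_inj; rewrite /= inordK.
Qed.

End Slot.

Lemma cls_disjoint (G H : {set 'I_k}) :
  (forall g, g \in G -> (g \in H) = false) ->
  forall e, e \in cls G -> (e \in cls H) = false.
Proof. by move=> GH e; rewrite !inE => /GH. Qed.

End Classes.

(** * The weighted two-class instance *)

Section Instance.
Context {R : realType}.
Variables (n k q : nat) (p d : R).
Hypotheses (k0 : (0 < k)%N) (qkn : (q.+1 * k <= n)%N) (nqk : (n <= q.+2 * k)%N)
  (p01 : 0 <= p <= 1) (d0 : 0 <= d).

(** After [q+1] full rounds of dealing, this many groups receive one more element. *)
Definition nbig : nat := n - q.+1 * k.
Definition nsmall : nat := k - nbig.
Definition gbig : {set 'I_k} := [set g : 'I_k | (g < nbig)%N]%SET.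
Definition gsmall : {set 'I_k} := [set g : 'I_k | (nbig <= g)%N]%SET.

Local Notation csmall := (@cls n k k0 gsmall).
Local Notation cbig := (@cls n k k0 gbig).
Local Notation hsmall := (@slot n k k0 q).
Local Notation hbig := (@slot n k k0 q.+1).

(** Both choice functions are defined on all [k] groups, so each Chernoff count applies directly and
    the index set is a plain product. *)
Definition hid_index : Type :=
  ({ffun 'I_k -> 'I_q.+1} * {ffun 'I_k -> 'I_q.+2})%type.
HB.instance Definition _ := Finite.on hid_index.

Definition osmall (phi : hid_index) := hidden_set csmall hsmall phi.1.
Definition obig (phi : hid_index) := hidden_set cbig hbig phi.2.

Lemma nbig_le : (nbig <= k)%N.
Proof. by rewrite leq_subLR addnC -mulSn. Qed.

Lemma card_gbig : #|gbig| = nbig.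
Proof.
rewrite -sum1_card (eq_bigl (fun g : 'I_k => (g < nbig)%N)); last first.
  by move=> g; rewrite inE.
by rewrite -(big_ord_widen _ (fun=> 1%N) nbig_le) sum1_card card_ord.
Qed.

Lemma card_gsmall : #|gsmall| = nsmall.
Proof.
have := cardsC gbig; rewrite card_gbig card_ord => E.
rewrite /nsmall -[in RHS]E addKn; apply: eq_card => g.
by rewrite !inE -leqNgt.
Qed.

Lemma small_slot (e : 'I_n) : grp k0 e \in gsmall -> (e %/ k <= q)%N.
Proof.
rewrite inE /= => H; rewrite leqNgt; apply/negP => H2.
have := ltn_ord e; rewrite {1}(divn_eq e k) ltnNge => /negP; apply.
apply: (@leq_trans (q.+1 * k + nbig)); first by rewrite subnKC.
by rewrite leq_add // leq_mul2r H2 orbT.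
Qed.

Lemma big_slot (e : 'I_n) : grp k0 e \in gbig -> (e %/ k <= q.+1)%N.
Proof. by move=> _; rewrite -ltnS ltn_divLR // (leq_trans _ nqk). Qed.

Lemma small_onto : [set hsmall e | e in csmall]%SET = finset.setX gsmall finset.setT.
Proof.
apply: slot_onto => g _; apply: leq_trans qkn.
by rewrite mulSn addnC ltn_add2r.
Qed.

Lemma big_onto : [set hbig e | e in cbig]%SET = finset.setX gbig finset.setT.
Proof. by apply: slot_onto => g; rewrite inE ltn_subRL. Qed.

Lemma card_osmall phi : #|osmall phi| = nsmall.
Proof.
by rewrite (card_hidden_setE _ _ (slot_inj _ _ _ small_slot) _ small_onto) card_gsmall.
Qed.

Lemma card_obig phi : #|obig phi| = nbig.
Proof.
by rewrite (card_hidden_setE _ _ (slot_inj _ _ _ big_slot) _ big_onto) card_gbig.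
Qed.

Lemma card_csmall : #|csmall| = (q.+1 * nsmall)%N.
Proof.
by rewrite (card_hidden_classE _ _ (slot_inj _ _ _ small_slot) _ small_onto) card_gsmall.
Qed.

Lemma card_cbig : #|cbig| = (q.+2 * nbig)%N.
Proof.
by rewrite (card_hidden_classE _ _ (slot_inj _ _ _ big_slot) _ big_onto) card_gbig.
Qed.

Definition inst (phi : hid_index) : setfun R n := fun S =>
  p * part q d nsmall (osmall phi) (csmall :\: osmall phi)%SET S +
  (1 - p) * part q.+1 d nbig (obig phi) (cbig :\: obig phi)%SET S.

(** The answer on balanced sets, which does not depend on the hidden set. *)
Definition sym_value : setfun R n := fun S =>
  p * (1 - (1 - #|(S :&: csmall)%SET|%:R / nsmall%:R / q.+1%:R) ^+ q.+1) +
  (1 - p) * (1 - (1 - #|(S :&: cbig)%SET|%:R / nbig%:R / q.+2%:R) ^+ q.+2).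

Definition balanced (phi : hid_index) (S : {set 'I_n}) : bool :=
  (#|(S :&: osmall phi)%SET|%:R <=
     #|(S :&: csmall)%SET|%:R / q.+1%:R + d * nsmall%:R) &&
  (#|(S :&: obig phi)%SET|%:R <=
     #|(S :&: cbig)%SET|%:R / q.+2%:R + d * nbig%:R).

Lemma osmall_sub phi : osmall phi \subset csmall.
Proof. by apply/fintype.subsetP => e; rewrite !inE => /andP[]. Qed.

Lemma obig_sub phi : obig phi \subset cbig.
Proof. by apply/fintype.subsetP => e; rewrite !inE => /andP[]. Qed.

Let part_disj (A B : {set 'I_n}) e : e \in A -> (e \in (B :\: A)%SET) = false.
Proof. by move=> eA; rewrite inE eA. Qed.

Let card_split (A B : {set 'I_n}) : A \subset B -> (#|A| + #|(B :\: A)%SET|)%N = #|B|.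
Proof. by move=> AB; rewrite cardsDS // subnKC // subset_leq_card. Qed.

Let small_card phi : (#|osmall phi| + #|(csmall :\: osmall phi)%SET| <= q.+1 * nsmall)%N.
Proof. by rewrite card_split ?osmall_sub // card_csmall. Qed.

Let big_card phi : (#|obig phi| + #|(cbig :\: obig phi)%SET| <= q.+2 * nbig)%N.
Proof. by rewrite card_split ?obig_sub // card_cbig. Qed.

Let osmall_card phi : (#|osmall phi| <= nsmall)%N.
Proof. by rewrite card_osmall. Qed.

Let obig_card phi : (#|obig phi| <= nbig)%N.
Proof. by rewrite card_obig. Qed.

Let p0 : 0 <= p. Proof. by case/andP: p01. Qed.
Let p1 : 0 <= 1 - p. Proof. by rewrite subr_ge0; case/andP: p01. Qed.

Lemma inst_valid phi : valid_instance (inst phi).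
Proof.
have sA := part_submodular _ _ _ _ _ d0 (part_disj _ _) (osmall_card phi) (small_card phi).
have sB := part_submodular _ _ _ _ _ d0 (part_disj _ _) (obig_card phi) (big_card phi).
have mA := part_monotone _ _ _ _ _ d0 (part_disj _ _) (osmall_card phi) (small_card phi).
have mB := part_monotone _ _ _ _ _ d0 (part_disj _ _) (obig_card phi) (big_card phi).
have nA := part_nonneg _ _ _ _ _ d0 (part_disj _ _) (osmall_card phi) (small_card phi).
have nB := part_nonneg _ _ _ _ _ d0 (part_disj _ _) (obig_card phi) (big_card phi).
split=> [S|A B AB|A B]; rewrite /inst.
- by rewrite addr_ge0 // mulr_ge0.
- by apply: lerD; apply: ler_wpM2l => //; [exact: mA|exact: mB].
- rewrite [leLHS]addrACA [leRHS]addrACA -!mulrDr.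
  by apply: lerD; apply: ler_wpM2l => //.
Qed.

Lemma inst_le1 phi S : inst phi S <= 1.
Proof.
have -> : 1 = p * 1 + (1 - p) * 1 :> R by ring.
rewrite lerD // ler_wpM2l //.
  exact: part_le1 d0 (osmall_card phi) (small_card phi) S.
exact: part_le1 d0 (obig_card phi) (big_card phi) S.
Qed.

Lemma part_balanced (m K : nat) (O C S : {set 'I_n}) : O \subset C ->
  #|(S :&: O)%SET|%:R <= #|(S :&: C)%SET|%:R / m.+1%:R + d * K%:R ->
  part m d K O (C :\: O)%SET S = 1 - (1 - #|(S :&: C)%SET|%:R / K%:R / m.+1%:R) ^+ m.+1.
Proof.
move=> OC H; rewrite /part; congr (1 - _).
have E : #|(S :&: C)%SET|%:R = #|(S :&: O)%SET|%:R + #|(S :&: (C :\: O))%SET|%:R :> R.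
  by rewrite -natrD -(cardsID O (S :&: C)%SET) -finset.setIA (finset.setIidPr OC) finset.setIDA.
rewrite hid_balanced -mulrDl -E //.
case: K {E} H => [|K] H; first by rewrite invr0 !mulr0 mul0r add0r.
have K0 : 0 < K.+1%:R :> R by rewrite ltr0n.
by rewrite ler_pdivrMr // mulrDl [_ / _ / _]mulrAC divfK ?gt_eqF.
Qed.

Lemma inst_balanced phi S : balanced phi S -> inst phi S = sym_value S.
Proof.
move=> /andP[bA bB]; rewrite /inst /sym_value.
by rewrite !part_balanced ?osmall_sub ?obig_sub.
Qed.

Lemma part_opt (m K : nat) (O Q S : {set 'I_n}) : d <= 1 / 2 -> (0 < K)%N ->
  #|O| = K -> O \subset S -> (forall e, e \in Q -> (e \in S) = false) ->
  1 - d <= part m d K O Q S.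
Proof.
move=> d2 K0 OK OS QS; rewrite /part lerD2l lerN2 (finset.setIidPr OS) OK.
have -> : (S :&: Q = finset.set0)%SET.
  apply/setP => e; rewrite !inE; case: (boolP (e \in Q)) => [/QS->//|_].
  by rewrite andbF.
by rewrite cards0 mul0r divff ?hid_opt // gt_eqF // ltr0n.
Qed.

(** The union of the hidden sets has exactly [k] elements and nearly covers both classes. An empty
    second class would contribute 0, hence the alternative [p = 1]. *)
Lemma opt_inst phi : d <= 1 / 2 -> (0 < nsmall)%N -> ((0 < nbig)%N \/ p = 1) ->
  1 - d <= opt (inst phi) k.
Proof.
move=> d2 K0 K1; pose S := (osmall phi :|: obig phi)%SET.
have dis e : e \in csmall -> (e \in cbig) = false.
  by apply: cls_disjoint => g; rewrite !inE leqNgt => /negbTE.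
have Sk : (#|S| <= k)%N.
  rewrite (leq_trans (leq_card_setU _ _).1) // card_osmall card_obig.
  by rewrite /nsmall subnK // nbig_le.
apply: (@le_trans _ _ (inst phi S)); last first.
  by rewrite /opt (bigD1 S) //= le_max lexx.
have HA : 1 - d <= part q d nsmall (osmall phi) (csmall :\: osmall phi)%SET S.
  apply: part_opt; rewrite ?card_osmall ?finset.subsetUl // => e.
  rewrite !finset.in_setD => /andP[/negbTE eO eC]; rewrite finset.in_setU eO /=.
  by apply/negP => /(fintype.subsetP (obig_sub phi)); rewrite dis.
rewrite /inst; case: K1 => [K1|->]; last by rewrite subrr mul0r mul1r addr0.
have HB : 1 - d <= part q.+1 d nbig (obig phi) (cbig :\: obig phi)%SET S.
  apply: part_opt; rewrite ?card_obig ?finset.subsetUr // => e.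
  rewrite !finset.in_setD => /andP[/negbTE eO eC]; rewrite finset.in_setU eO orbF.
  by apply/negP => /(fintype.subsetP (osmall_sub phi)) /dis; rewrite eC.
by have -> : 1 - d = p * (1 - d) + (1 - p) * (1 - d); [ring|rewrite lerD // ler_wpM2l].
Qed.

(** A union bound over the two classes. The deviation [tau * k] fits into the slack [d] times the
    number of groups; an empty second class cannot be unbalanced. *)
Lemma unbalanced_rare (tau : R) S : 0 <= tau -> tau <= 2 ->
  tau * k%:R <= d * nsmall%:R -> (nbig = 0%N \/ tau * k%:R <= d * nbig%:R) ->
  #|[set phi | ~~ balanced phi S]%SET|%:R <=
    #|{: hid_index}|%:R * (2 * expR (- (tau ^+ 2 / 8 * k%:R))) :> R.
Proof.
move=> t0 t2 tA tB; set E := expR _.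
pose B1 := [set f | #|(S :&: csmall)%SET|%:R / q.+1%:R + tau * k%:R <
     #|(S :&: hidden_set csmall hsmall f)%SET|%:R :> R]%SET.
pose B2 := [set f | #|(S :&: cbig)%SET|%:R / q.+2%:R + tau * k%:R <
     #|(S :&: hidden_set cbig hbig f)%SET|%:R :> R]%SET.
have I1 : #|B1|%:R <= (q.+1 ^ k)%:R * E.
  by apply: hidden_set_chernoff => //; exact: slot_inj small_slot.
have I2 : #|B2|%:R <= (q.+2 ^ k)%:R * E.
  by apply: hidden_set_chernoff => //; exact: slot_inj big_slot.
have sub : [set phi | ~~ balanced phi S]%SET \subset
    (finset.setX B1 finset.setT :|: finset.setX finset.setT B2)%SET.
  apply/fintype.subsetP => -[f1 f2]; rewrite !inE /balanced negb_and -!ltNge andbT /=.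
  case/orP => [H|H]; apply/orP; [left|right].
    by apply: le_lt_trans H; rewrite lerD2l.
  case: tB => [b0|tB]; last by apply: le_lt_trans H; rewrite lerD2l.
  move: H; rewrite ltNge => /negP[].
  have -> : #|(S :&: obig (f1, f2))%SET| = 0%N.
    apply/eqP; rewrite -leqn0 -[leqRHS]b0 -(card_obig (f1, f2)).
    exact/subset_leq_card/finset.subsetIr.
  by rewrite addr_ge0 ?divr_ge0 ?mulr_ge0.
have NE : #|{: hid_index}| = (q.+1 ^ k * q.+2 ^ k)%N.
  by rewrite card_prod !card_ffun !card_ord.
have L : (#|[set phi | ~~ balanced phi S]%SET| <= #|B1| * q.+2 ^ k + q.+1 ^ k * #|B2|)%N.
  apply: leq_trans (subset_leq_card sub) _.
  apply: leq_trans (leq_card_setU _ _).1 _.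
  by rewrite !cardsX !cardsT !card_ffun !card_ord.
apply: (@le_trans _ _ ((#|B1| * q.+2 ^ k + q.+1 ^ k * #|B2|)%N%:R)).
  by rewrite ler_nat.
rewrite NE natrD !natrM.
apply: (@le_trans _ _ ((q.+1 ^ k)%:R * E * (q.+2 ^ k)%:R + (q.+1 ^ k)%:R * ((q.+2 ^ k)%:R * E))).
  by rewrite lerD // ?ler_wpM2r ?ler_wpM2l.
by rewrite le_eqVlt; apply/orP; left; apply/eqP; ring.
Qed.

End Instance.

(** * The oracle that reveals nothing *)

Section SymValue.
Context {R : realType}.
Variables (n k q : nat) (p : R).
Hypotheses (k0 : (0 < k)%N) (qkn : (q.+1 * k <= n)%N) (nqk : (n <= q.+2 * k)%N)
  (p01 : 0 <= p <= 1).

(** With [d = 1] every set is balanced, as a hidden set has only one element per group, so this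
    function is itself an [inst]. *)
Lemma sym_value_valid : valid_instance (sym_value n k q p k0).
Proof.
pose phi : hid_index k q := ([ffun=> ord0], [ffun=> ord0]).
have E S : inst n k q p 1 k0 phi S = sym_value n k q p k0 S.
  apply: inst_balanced; first exact: ler01.
  apply/andP; split; rewrite mul1r;
    apply: ler_wpDl; rewrite ?divr_ge0 // ler_nat.
    rewrite -[leqRHS](card_osmall n k q k0 qkn nqk phi).
    exact/subset_leq_card/finset.subsetIr.
  rewrite -[leqRHS](card_obig n k q k0 nqk phi).
  exact/subset_leq_card/finset.subsetIr.
have [fn fm fs] := inst_valid n k q p 1 k0 qkn nqk p01 ler01 phi.
split=> [S|A B AB|A B]; rewrite -!E; [exact: fn|exact: fm|exact: fs].
Qed.

(** The fractions taken from the two classes meet the budget of the game: multiplied by [n], its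
    constraint compares the chosen elements with [k]. *)
Lemma sym_value_le (c r : R) (S : {set 'I_n}) : c * n%:R = k%:R -> 0 <= c ->
  (forall x y : R, 0 <= x <= 1 -> 0 <= y <= 1 ->
    (q.+2%:R * c - 1) * (q.+1%:R * x) + (1 - q.+1%:R * c) * (q.+2%:R * y) <= c ->
    p * (1 - (1 - x) ^+ q.+1) + (1 - p) * (1 - (1 - y) ^+ q.+2) <= r) ->
  (#|S| <= k)%N -> sym_value n k q p k0 S <= r.
Proof.
move=> cE c0 game Sk.
have n0 : 0 < n%:R :> R.
  by rewrite ltr0n; apply: leq_trans qkn; rewrite muln_gt0.
have le (C : {set 'I_n}) (K m : nat) : #|C| = (m.+1 * K)%N ->
    let v : R := #|(S :&: C)%SET|%:R / K%:R / m.+1%:R in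
    0 <= v <= 1 /\ K%:R * (m.+1%:R * v) = #|(S :&: C)%SET|%:R.
  move=> CK /=; have SC : (#|(S :&: C)%SET| <= m.+1 * K)%N.
    by rewrite -CK; exact/subset_leq_card/finset.subsetIr.
  rewrite !divr_ge0 //=; case: K CK SC => [|K] CK SC.
    by move: SC; rewrite muln0 leqn0 => /eqP->; rewrite !mul0r ler01.
  split; last by field; rewrite !gt_eqF // -?natr1; have := ler0n R K; have := ler0n R m; lra.
  by rewrite !ler_pdivrMr ?ltr0n // mul1r -natrM ler_nat.
have [x01 xE] := le _ _ _ (card_csmall n k q k0 qkn nqk).
have [y01 yE] := le _ _ _ (card_cbig n k q k0 nqk).
apply: game => //; rewrite -(ler_pM2r n0) cE.
have bE : (1 - q.+1%:R * c) * n%:R = (nbig n k q)%:R.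
  by rewrite /nbig natrB // natrM -cE; ring.
have aE : (q.+2%:R * c - 1) * n%:R = (nsmall n k q)%:R.
  by rewrite /nsmall natrB ?nbig_le // -bE -cE -[q.+2%:R]natr1; ring.
rewrite mulrDl ![_ * _ * n%:R]mulrAC aE bE xE yE -natrD ler_nat.
apply: leq_trans Sk; rewrite -cardsUI -finset.setIUr finset.setIACA finset.setIid.
have -> : (cls k0 (gsmall n k q) :&: cls k0 (gbig n k q) = finset.set0 :> {set 'I_n})%SET.
  by apply/setP => e; rewrite !inE leqNgt andNb.
rewrite finset.setI0 cards0 addn0.
exact/subset_leq_card/finset.subsetIl.
Qed.

End SymValue.

(** * Averaging over the hidden set *)

Lemma measurable_finite_comp {d d'} {Omega : measurableType d} {U : measurableType d'}
    {T : finType} (g : Omega -> T) (h : T -> U) :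
  (forall t, measurable [set w | g w = t]) -> measurable_fun setT (h \o g).
Proof.
move=> mg _ Y _; rewrite setTI.
have -> : (h \o g) @^-1` Y =
    \bigcup_(t in [set t | Y (h t)]) [set w | g w = t].
  by apply/seteqP; split=> [w /= Yw|w [t /= Yt E]]; [exists (g w)|rewrite /= E].
by apply: fin_bigcup_measurable => // t _; exact: mg.
Qed.

Lemma measurable_nat_ge {R : realType} {d} {Omega : measurableType d}
    (g : Omega -> nat) (M : R) :
  (forall m, measurable [set w | g w = m]) -> measurable [set w | M <= (g w)%:R].
Proof.
move=> mg; have -> : [set w | M <= (g w)%:R] =
    \bigcup_(m in [set m | M <= m%:R]) [set w | g w = m].
  by apply/seteqP; split=> [w /= Mw|w [m /= Mm E]]; [exists (g w)|rewrite /= E].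
by apply: bigcup_measurable => m _; exact: mg.
Qed.

Section Averaging.
Context {R : realType} {n : nat} {d : measure_display} {Omega : measurableType d}.
Variables (P : probability Omega R) (A : Omega -> qalg R n) (k : nat).
Variables (I : finType) (F : I -> setfun R n) (f0 : setfun R n).
Variables (good : I -> {set 'I_n} -> bool) (v M beta : R).
Hypotheses (mA : ralg_measurable A)
  (F0 : forall i S, 0 <= F i S) (F1 : forall i S, F i S <= 1)
  (goodE : forall i S, good i S -> F i S = f0 S)
  (v0 : 0 <= v) (f0v : forall S : {set 'I_n}, (#|S| <= k)%N -> f0 S <= v)
  (beta0 : 0 <= beta)
  (rare : forall S, #|[set i | ~~ good i S]%SET|%:R <= #|I|%:R * beta)
  (M0 : 0 <= M) (PM : P [set w | M <= (nqueries f0 (A w))%:R] = 0%E).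

(** If every set in the trace is good for [i], the run is the one on [f0] and earns at most [v];
    otherwise it earns at most 1, charged to a bad set in the trace. Exchanging sums, each of fewer
    than [M + 1] sets is bad for at most a [beta] fraction of the [i]. *)
Lemma sum_out_value w : (nqueries f0 (A w))%:R < M ->
  \sum_i out_value (F i) k (qout (F i) (A w)) <= #|I|%:R * (v + (M + 1) * beta).
Proof.
move=> wM; set T := trace f0 (A w).
have H i : out_value (F i) k (qout (F i) (A w)) <= v + \sum_(S <- T) (~~ good i S)%:R.
  have [/allP Tg|/allPn[S ST Sb]] := boolP (all (good i) T).
    rewrite (qout_eq_trace f0) => [|S ST]; last by apply: goodE; exact: Tg.
    apply: ler_wpDr; first by apply: sumr_ge0.
    rewrite /out_value; case: ifP => [Sk|_ //].
    by rewrite goodE ?f0v //; apply: Tg; exact: qout_trace.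
  apply: ler_wpDl => //; apply: (@le_trans _ _ 1).
    by rewrite /out_value; case: ifP => _ //; rewrite ler01.
  rewrite (big_rem S) //= (negbTE Sb) /= ler_wpDr //.
  by apply: sumr_ge0.
apply: (le_trans (ler_sum _ (fun i _ => H i))).
rewrite big_split /= sumr_const -[v *+ _]mulr_natl mulrDr lerD2l exchange_big /=.
apply: (@le_trans _ _ (\sum_(S <- T) #|I|%:R * beta)).
  apply: ler_sum => S _; apply: le_trans (rare S).
  by rewrite -sum1_card natr_sum [leRHS]big_mkcond; apply: ler_sum => i _; rewrite inE; case: good.
rewrite big_const_seq count_predT size_trace iter_addr_0 -[leLHS]mulr_natl [leLHS]mulrCA.
by apply: ler_wpM2l => //; apply: ler_wpM2r => //; rewrite -natr1 lerD2r ltW.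
Qed.

(** The bound for each fixed random seed is integrated; seeds with [M] or more queries on [f0] form
    a null set. *)
Lemma expected_value_sum :
  (\sum_i expected_value P A (F i) k <= (#|I|%:R * (v + (M + 1) * beta))%:E)%E.
Proof.
have [mo mq] := mA.
have mF i : measurable_fun setT
      ((fun w => (out_value (F i) k (qout (F i) (A w)))%:E) : Omega -> \bar R).
  by apply: (measurable_finite_comp (fun w => qout (F i) (A w))
    (fun S => (out_value (F i) k S)%:E)) => S; exact: mo.
have pF i S : 0 <= out_value (F i) k S by rewrite /out_value; case: ifP.
rewrite /expected_value -(ge0_integral_sum P measurableT mF); last first.
  by move=> i w _; rewrite lee_fin.
have B0 : 0 <= #|I|%:R * (v + (M + 1) * beta) by rewrite mulr_ge0 ?addr_ge0 ?mulr_ge0 ?addr_ge0.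
have -> : ((#|I|%:R * (v + (M + 1) * beta))%:E =
    \int[P]_(w in setT) cst (#|I|%:R * (v + (M + 1) * beta))%:E w)%E.
  rewrite (integral_cst P measurableT).
  rewrite -[LHS]mule1; congr (_ * _)%E; exact: esym (probability_setT P).
apply: ae_ge0_le_integral => //.
- by move=> w _; apply: sume_ge0 => i _; rewrite lee_fin.
- exact: emeasurable_sum.
exists [set w | M <= (nqueries f0 (A w))%:R]; split=> //.
  by apply: measurable_nat_ge => m; exact: mq.
move=> w /= wn; apply: contrapT => /negP; rewrite -ltNge => wM; apply: wn => _.
by rewrite sumEFin lee_fin; exact: sum_out_value.
Qed.

End Averaging.

(** * Choice of constants and the final contradiction *)

Theorem theorem1p4 (R : realType) (c : rat) (eps r : R) :
  0 < c -> c <= 1 -> 0 < eps -> is_rho (ratr c) r ->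
  exists2 delta : R, 0 < delta &
  exists N : nat, forall n k : nat, (N <= n)%N -> (ratr c : R) * n%:R = k%:R ->
  forall (d : measure_display) (Omega : measurableType d)
         (P : probability Omega R) (A : Omega -> qalg R n),
    ralg_measurable A ->
    (forall f : setfun R n, valid_instance f ->
       (((1 + eps) * r * opt f k)%:E <= expected_value P A f k)%E) ->
    exists2 f : setfun R n, valid_instance f &
      (0 < P [set w : Omega | (expR (delta * n%:R) <= (nqueries f (A w))%:R)%R])%E.
Proof.
move=> c0 _ eps0; have {c0} := c0; rewrite -(ltr0q R); move: (ratr c) => {}c c0.
move=> /(rho_game _ _ c0)[q [p [[p01 r0 qc qc2 pE] game]]].
pose a := q.+2%:R * c - 1; pose b := 1 - q.+1%:R * c.
have a0 : 0 < a by rewrite subr_gt0.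
have b0 : 0 <= b by rewrite subr_ge0.
have ab : a + b = c by rewrite /a /b -[q.+2%:R]natr1; ring.
(* Losing a fraction [d] of the optimum still leaves the ratio [1 + eps / 2]. *)
pose d := eps / (2 * (1 + eps)).
have d0 : 0 < d by rewrite divr_gt0 // mulr_gt0 // addr_gt0.
have dE : (1 + eps) * (1 - d) = 1 + eps / 2.
  by rewrite /d; field; rewrite gt_eqF // addr_gt0.
have d2 : d <= 1 / 2.
  by rewrite /d ler_pdivrMr ?mulr_gt0 ?addr_gt0 //; lra.
(* the smallest class density, among the nonempty classes *)
pose mu := if b == 0 then a else Num.min a b.
have mu0 : 0 < mu.
  rewrite /mu; case: eqP => // /eqP bn; rewrite lt_min a0 lt_neqAle eq_sym bn.
  exact: b0.
have mua : mu <= a by rewrite /mu; case: ifP => // _; rewrite ge_min lexx.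
have mub : b = 0 \/ mu <= b.
  by rewrite /mu; case: eqP => [->|_]; [left|right; rewrite ge_min lexx orbT].
(* Makes [tau * k = d * (mu * n)], the slack of the smallest nonempty class. *)
pose tau := d * mu / c.
have tau0 : 0 < tau by rewrite divr_gt0 // mulr_gt0.
have tau2 : tau <= 2.
  by rewrite ler_pdivrMr //; nra.
(* Half the Chernoff exponent: [expR (delta * n)] queries times the failure bound still decay
   exponentially. *)
pose delta := tau ^+ 2 / 8 * c / 2.
have delta0 : 0 < delta by rewrite divr_gt0 // mulr_gt0 // divr_gt0 // exprn_gt0.
exists delta => //; exists (Num.bound (8 / (eps * r) / delta)).+1.
move=> n k Nn cE dsp Omega P A mA approx.
have n0 : 0 < n%:R :> R by rewrite ltr0n (leq_trans _ Nn).
have k0 : (0 < k)%N by rewrite -(ltr0n R) -cE mulr_gt0.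
have qkn : (q.+1 * k <= n)%N.
  by rewrite -(ler_nat R) natrM -cE mulrA ler_piMl // ltW.
have nqk : (n <= q.+2 * k)%N.
  by rewrite -(ler_nat R) natrM -cE mulrA ler_peMl // ltW.
have bE : (nbig n k q)%:R = b * n%:R.
  by rewrite /nbig natrB // natrM -cE /b; ring.
have aE : (nsmall n k q)%:R = a * n%:R.
  by rewrite /nsmall natrB ?nbig_le // bE -cE -ab; ring.
pose f0 := sym_value n k q p k0 : setfun R n.
(* The function that forces many queries is the symmetric oracle. Were they almost surely few,
   averaging over the hidden sets would contradict the guarantee. *)
exists f0; first exact: sym_value_valid.
rewrite lt_neqAle measure_ge0 andbT eq_sym; apply/eqP => P0.
pose N := #|{: hid_index k q}|.
have N0 : 0 < N%:R :> R.
  by rewrite ltr0n; apply/card_gt0P; exists ([ffun=> ord0], [ffun=> ord0]).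
pose beta := 2 * expR (- (tau ^+ 2 / 8 * k%:R)).
have valid phi := inst_valid n k q p d k0 qkn nqk p01 (ltW d0) phi.
have tk : tau * k%:R = d * (mu * n%:R).
  by rewrite -cE /tau; field; rewrite gt_eqF.
have le_exp := expected_value_sum P A k (hid_index k q)
  (inst n k q p d k0) f0 (balanced n k q d k0) r (expR (delta * n%:R)) beta mA
  (fun phi S => let: And3 h _ _ := valid phi in h S)
  (inst_le1 n k q p d k0 qkn nqk p01 (ltW d0))
  (inst_balanced n k q p d k0 (ltW d0)) (ltW r0)
  (fun S => sym_value_le n k q p k0 qkn nqk c r S cE (ltW c0) game)
  (mulr_ge0 (ler0n _ 2) (expR_ge0 _)).
have {le_exp} le_exp : (\sum_(phi : hid_index k q) ((1 + eps) * r * (1 - d))%:E <=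
    (N%:R * (r + (expR (delta * n%:R) + 1) * beta))%:E)%E.
  apply: le_trans (le_exp _ (expR_ge0 _) P0).
    apply: lee_sum => phi _; apply: le_trans (approx _ (valid phi)).
    rewrite lee_fin ler_wpM2l ?mulr_ge0 ?addr_ge0 ?(ltW r0) ?(ltW eps0) //.
    apply: opt_inst => //; rewrite ?(ltW d0) //.
      by rewrite -(ltr0n R) aE mulr_gt0.
    have [b1|b1] := eqVneq b 0; first by right; apply: pE; move/eqP: b1; rewrite subr_eq0 => /eqP.
    by left; rewrite -(ltr0n R) bE mulr_gt0 // lt_neqAle eq_sym b1 b0.
  move=> S; apply: unbalanced_rare => //; rewrite ?(ltW tau0) ?(ltW d0) ?tk //.
    by rewrite aE ler_wpM2l ?(ltW d0) // ler_wpM2r // ltW.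
  case: mub => [b1|mub]; [left|right].
    by apply/eqP; rewrite -(eqr_nat R) bE b1 mul0r.
  by rewrite bE ler_wpM2l ?(ltW d0) // ler_wpM2r // ltW.
move: le_exp; rewrite sumEFin lee_fin sumr_const -[leLHS]mulr_natl -/N ler_pM2l //.
have -> : (1 + eps) * r * (1 - d) = r + eps * r / 2 by rewrite mulrAC dE; ring.
(* With [y = expR (delta * n)], the excess is [2 (y + 1) / y^2 <= 4 / y], below [eps * r / 2] once
   [y > 8 / (eps * r)]. *)
rewrite lerD2l leNgt => /negP; apply.
have E2 : beta = 2 * expR (- (delta * n%:R)) ^+ 2.
  by rewrite /beta -expRM_natl -cE /delta; congr (2 * expR _); field.
set y := expR (delta * n%:R).
have y0 : 0 < y by exact: expR_gt0.
have er0 : 0 < eps * r by rewrite mulr_gt0.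
have y8 : 8 / (eps * r) < y.
  have : 1 + delta * n%:R <= y by exact: expR_ge1Dx.
  apply: lt_le_trans; apply: ltr_wpDl => //.
  have b8 : 0 <= 8 / (eps * r) / delta.
    by apply: divr_ge0; [apply: divr_ge0 => //|]; exact: ltW.
  rewrite [delta * _]mulrC -ltr_pdivrMr //.
  by apply: lt_le_trans (archi_boundP b8) _; rewrite ler_nat ltnW.
have y1 : 1 <= y by rewrite -[leLHS]expR0 ler_expR mulr_ge0 // ltW.
rewrite E2 expRN -/y.
have -> : (y + 1) * (2 * y^-1 ^+ 2) = 2 * (y + 1) / y ^+ 2.
  by field; rewrite gt_eqF.
rewrite ltr_pdivrMr ?exprn_gt0 //.
move: y8; rewrite ltr_pdivrMr // => y8.
have : 8 * y < y * (eps * r) * y by rewrite ltr_pM2r.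
nra.
Qed.
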